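(* Let $G=(V,E)$ be a multigraph with $m$ edges (loops counted) and rank $r=|V|-c(E)$. Then $$h^\ast(\mathcal C_G;z)=(1+z)^{m-r}(2z)^r\,T_G\!\left(\frac{1+3z}{2z},\,1\right).$$
   Context: For a finite undirected multigraph $G=(V,E)$ (loops, parallel edges and isolated nodes allowed) with $n=|V|$, $m=|E|$, work in $\mathbb{R}^V\times\mathbb{R}^E\cong\mathbb{R}^{n+m}$ with standard basis vectors $e_u$, $e_f$. For each edge $f$ with endpoints $u,v$ ($u=v$ for a loop) set $\widetilde e_f=e_u+e_v-e_f$, $\overleftarrow e_f=e_u-e_v+e_f$, $\overrightarrow e_f=-e_u+e_v+e_f$. The cosmological polytope $\mathcal C_G$ is the convex hull of $\{e_f,\widetilde e_f,\overleftarrow e_f,\overrightarrow e_f: f\in E\}\cup\{e_u: u\in V\}$, a lattice polytope of dimension $n+m-1$. For a $d$-dimensional lattice polytope $P\subseteq\mathbb{R}^N$, the $h^\ast$-polynomial is defined by $\sum_{j\ge0}|jP\cap\mathbb{Z}^N|z^j=h^\ast(P;z)/(1-z)^{d+1}$. For $H\subseteq E$, $c(H)$ is the number of connected components of the graph $(V,H)$ (isolated nodes count as components). The Tutte polynomial is $T_G(x,y)=\sum_{H\subseteq E}(x-1)^{c(H)-c(E)}(y-1)^{c(H)+|H|-|V|}$. *)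

(* Defs.v *)
From HB Require Import structures.
From mathcomp Require Import all_boot all_order all_algebra.
Set Implicit Arguments. Unset Strict Implicit. Unset Printing Implicit Defensive.
Import Order.TTheory GRing.Theory Num.Theory.
Local Open Scope ring_scope.

(* A finite multigraph with vertex set 'I_n and edge set 'I_m; edge f has
   endpoints (ends f).1 and (ends f).2 (equal for a loop).  Parallel edges,
   loops and isolated nodes are allowed. *)

Definition coord_t (n m : nat) := ('I_n + 'I_m)%type.

Definition basisv (R : pzRingType) (n m : nat) (c : coord_t n m) : coord_t n m -> R :=
  fun d => (d == c)%:R.

(* Index set of the generating points: e_u (u in V), and for each edge f the
   four points e_f, ~e_f, <-e_f, ->e_f (k = 0,1,2,3). *)
Definition gen_idx (n m : nat) := ('I_n + ('I_m * 'I_4))%type.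

Definition cosmo_gen (R : pzRingType) (n m : nat) (ends : 'I_m -> 'I_n * 'I_n)
    (i : gen_idx n m) : coord_t n m -> R :=
  match i with
  | inl u => @basisv R n m (inl u)
  | inr (f, k) =>
      let eu := @basisv R n m (inl (ends f).1) in
      let ev := @basisv R n m (inl (ends f).2) in
      let ef := @basisv R n m (inr f) in
      fun d =>
        match val k with
        | 0 => ef d
        | 1 => eu d + ev d - ef d
        | 2 => eu d - ev d + ef d
        | _ => - eu d + ev d + ef d
        end
  end.

Definition in_dilate_cosmo (R : realFieldType) (n m : nat)
    (ends : 'I_m -> 'I_n * 'I_n) (j : nat) (x : coord_t n m -> R) : Prop :=
  exists lam : gen_idx n m -> R,
    (forall i, 0 <= lam i) /\ \sum_i lam i = 1 /\
    forall d, x d = j%:R * \sum_i lam i * @cosmo_gen R n m ends i d.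

(* h^* polynomial of C_G (dimension d = n + m - 1), via coefficient extraction in
   sum_j |jP cap Z^N| z^j = h(z) / (1 - z)^(d+1):
   |jP cap Z^N| = sum_(i <= j) h_i * C(j - i + d, d);
   the existence of the duplicate-free list s asserts finiteness. *)
Definition is_hstar_cosmo (R : realFieldType) (n m : nat)
    (ends : 'I_m -> 'I_n * 'I_n) (h : {poly rat}) : Prop :=
  forall j : nat, exists s : seq {ffun coord_t n m -> int},
    [/\ uniq s,
        (forall z : {ffun coord_t n m -> int},
            z \in s <-> @in_dilate_cosmo R n m ends j (fun d => (z d)%:~R)) &
        (size s)%:R = \sum_(i < j.+1)
                        h`_i * ('C(j - i + (n + m).-1, (n + m).-1))%:R].

Definition adjH (n m : nat) (ends : 'I_m -> 'I_n * 'I_n) (H : {set 'I_m}) : rel 'I_n :=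
  fun u v => [exists f in H, (ends f == (u, v)) || (ends f == (v, u))].

Definition ncomp (n m : nat) (ends : 'I_m -> 'I_n * 'I_n) (H : {set 'I_m}) : nat :=
  n_comp (adjH ends H) [set: 'I_n].

Definition grank (n m : nat) (ends : 'I_m -> 'I_n * 'I_n) : nat :=
  n - ncomp ends [set: 'I_m].

(* Tutte polynomial evaluated at (x, y) in a field F (the exponents
   c(H)-c(E) and c(H)+|H|-|V| are nonnegative, so nat subtraction is exact). *)
Definition tutte (F : fieldType) (n m : nat) (ends : 'I_m -> 'I_n * 'I_n) (x y : F) : F :=
  \sum_(H : {set 'I_m})
     (x - 1) ^+ (ncomp ends H - ncomp ends [set: 'I_m]) *
     (y - 1) ^+ (ncomp ends H + #|H| - n).

Notation tofracF := (@FracField.tofrac _).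

(* Main.v *)
Require Import Defs.
From HB Require Import structures.
From mathcomp Require Import all_boot all_order all_algebra.
From mathcomp Require Import zify ring lra.
Set Implicit Arguments. Unset Strict Implicit. Unset Printing Implicit Defensive.
Import Order.TTheory GRing.Theory Num.Theory.
Local Open Scope ring_scope.

(* In the unimodular coordinates x_u = a_u + sum_f b_f ([u = u_f] + [u = v_f])
   a lattice point (a, b) of R^V x R^E lies in j C_G iff, for all U in V,
   x(U) >= sum of 2 max(0, b_f) over the edges f with both ends in U, and
   x(V) = j + sum_f b_f: necessity is read off the generators, sufficiency is a
   Hall-type splitting of the supermodular right-hand side edge by edge.
   For fixed b these x form the lattice points of a base polyhedron B(g).  If
   g' is g plus w on the sets containing both ends of an edge uv, then B(g')
   fibres over the contraction B(g/uv), each fibre being an integer interval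
   w longer than the corresponding fibre of B(g); hence
   |B(g')| = |B(g)| + w |B(g/uv)|.  Summing over the value of b on one edge
   gives the deletion-contraction rule
   h(G) = (1 + z) h(G - e) + 2 z h(G / e)   (without second term for a loop),
   whose solution sum_F (1 + z)^(m - |F|) (2 z)^|F| over the forests F is the
   Tutte evaluation at y = 1. *)

(** * Counting through fibres *)

(** The predicates counted live on infinite types such as [{ffun T -> int}], so a count is witnessed
    by a duplicate-free list, as in [is_hstar_cosmo]. *)
Definition has_card (T : eqType) (P : pred T) (N : nat) : Prop :=
  exists s : seq T, [/\ uniq s, s =i P & size s = N].

Lemma has_card_uniq (T : eqType) (P : pred T) N N' :
  has_card P N -> has_card P N' -> N = N'.
Proof.
move=> [s [us sP <-]] [s' [us' sP' <-]].
by apply: perm_size; apply: uniq_perm => // x; rewrite sP sP'.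
Qed.

Lemma has_card_bij (T T' : eqType) (P : pred T) (Q : pred T') (f : T -> T')
    (g : T' -> T) N :
  (forall x, P x -> Q (f x) /\ g (f x) = x) ->
  (forall y, Q y -> P (g y) /\ f (g y) = y) ->
  has_card P N -> has_card Q N.
Proof.
move=> fP gQ [s [us sP <-]]; exists (map f s); split; last by rewrite size_map.
  rewrite map_inj_in_uniq // => x y; rewrite !sP => xP yP fxy.
  by rewrite -(fP x xP).2 -(fP y yP).2 fxy.
move=> y; apply/mapP/idP => [[x xs ->]|yQ].
  by rewrite sP in xs; exact: (fP _ xs).1.
by have [gyP fgy] := gQ _ yQ; exists (g y); rewrite ?sP.
Qed.

Lemma eq_has_card (T : eqType) (P Q : pred T) N :
  P =1 Q -> has_card P N -> has_card Q N.
Proof. by move=> PQ; apply: has_card_bij (id) (id) _ _ _ => x; rewrite ?PQ // -PQ. Qed.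

Lemma has_card_fibre (T I : eqType) (key : T -> I) (r : seq I) (P : pred T)
    (N : I -> nat) :
  uniq r -> (forall x, P x -> key x \in r) ->
  (forall i, i \in r -> has_card [pred x | P x && (key x == i)] (N i)) ->
  has_card P (\sum_(i <- r) N i).
Proof.
elim: r P => [|i r IHr] P /=.
  move=> _ Pr _; exists [::]; split=> //; last by rewrite big_nil.
  by move=> x; apply/esym/negP => /Pr.
move=> /andP[ir ur] Pr cP.
have [s [us sP sN]] := cP i (mem_head _ _).
have [||s' [us' sP' sN']] := IHr [pred x | P x && (key x != i)] ur.
- by move=> x /= /andP[/Pr]; rewrite inE => /orP[->|].
- move=> k kr; have ki : k != i by apply: contraNneq ir => <-.
  apply: eq_has_card (cP k _); last by rewrite inE kr orbT.
  by move=> x /=; case: eqP => [->|]; rewrite ?andbF ?ki ?andbT.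
exists (s ++ s'); split; last by rewrite size_cat sN sN' big_cons.
- rewrite cat_uniq us us' andbT /=; apply/hasPn => x.
  by rewrite sP' sP !inE => /andP[_ /negbTE->]; rewrite andbF.
by move=> x; rewrite mem_cat sP sP' !inE -andb_orr orbN andbT.
Qed.

Lemma has_card_interval (lo : int) (l : nat) :
  has_card [pred s : int | lo <= s < lo + l%:Z] l.
Proof.
exists [seq lo + k%:Z | k <- iota 0 l]; split; last by rewrite size_map size_iota.
  by rewrite map_inj_uniq ?iota_uniq // => x y; lia.
move=> s; apply/mapP/idP => [[k]|]; rewrite inE.
  by rewrite mem_iota; lia.
by move=> H; exists `|s - lo|%N; rewrite ?mem_iota; lia.
Qed.

Lemma ex_min_set (T : finType) (P : pred {set T}) (F : {set T} -> int) U0 :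
  P U0 -> exists2 U, P U & forall W, P W -> F U <= F W.
Proof. by move=> PU0; case: (arg_minP F PU0) => U PU H; exists U. Qed.

(** * Integer base polyhedra of set functions *)

Section Base.
Variable T : finType.
Implicit Types (U W A : {set T}) (x y : {ffun T -> int}) (g : {set T} -> int).

Definition mass x U : int := \sum_(u in U) x u.

Definition inside (e : T * T) U := (e.1 \in U) && (e.2 \in U).

Definition supermodular g := forall U W, g U + g W <= g (U :|: W) + g (U :&: W).

(* Lattice points, supported on A, of the base polyhedron of g with total t. *)
Definition base A g (t : int) x :=
  [&& [forall u, (u \notin A) ==> (x u == 0)], mass x setT == t &
      [forall U, g U <= mass x U]].

Lemma baseP A g t x :
  reflect [/\ forall u, u \notin A -> x u = 0, mass x setT = t &
              forall U, g U <= mass x U] (base A g t x).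
Proof.
apply: (iffP and3P) => [[/forallP h1 /eqP h2 /forallP h3]|[h1 h2 h3]]; split=> //.
- by move=> u uA; apply/eqP; move: (h1 u); rewrite uA.
- by apply/forallP=> u; apply/implyP => /h1->.
- by apply/eqP.
- by apply/forallP.
Qed.

Lemma mass_modular x U W : mass x U + mass x W = mass x (U :|: W) + mass x (U :&: W).
Proof.
rewrite /mass !(big_mkcond (fun i => i \in _)) -!big_split /=.
by apply: eq_bigr => u _; rewrite !inE; case: (u \in U); case: (u \in W); rewrite /= ?addr0 ?add0r.
Qed.

Definition spike (u : T) (c : int) : {ffun T -> int} :=
  [ffun i => if i == u then c else 0].

Lemma mass_spike u c U : mass (spike u c) U = if u \in U then c else 0.
Proof.
rewrite /mass (big_mkcond (fun i => i \in _)) (bigD1 u) //= big1 ?addr0 ?ffunE ?eqxx // => i iu.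
by rewrite ffunE (negbTE iu); case: ifP.
Qed.

Lemma massD x y U : mass (x + y) U = mass x U + mass y U.
Proof. by rewrite /mass -big_split; apply: eq_bigr => i _; rewrite ffunE. Qed.

Lemma massB x y U : mass (x - y) U = mass x U - mass y U.
Proof. by rewrite /mass -sumrB; apply: eq_bigr => i _; rewrite !ffunE. Qed.

(* Contraction keeps the vertex type: v is sent to u and leaves the support A. *)
Definition merge (u v : T) : T -> T := fun i => if i == v then u else i.

End Base.

(** * Contracting an edge *)

(** Choice along a finite list, obtained by induction rather than from an axiom. *)
Lemma ex_fun_seq (T : eqType) (r : seq T) (R : T -> nat -> Prop) :
  (forall i, i \in r -> exists n, R i n) ->
  exists f, forall i, i \in r -> R i (f i).
Proof.
elim: r => [|i r IHr] H; first by exists (fun=> 0%N).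
have [n Rn] := H i (mem_head _ _).
have [|f Rf] := IHr; first by move=> k kr; apply: H; rewrite inE kr orbT.
exists (fun k => if k == i then n else f k) => k.
by rewrite inE; case: eqP => [->|_] //= /Rf.
Qed.

Section Line.
Variable T : finType.
Implicit Types (U W A : {set T}) (x y : {ffun T -> int}) (g : {set T} -> int).

Lemma massU1 x v U : mass x (v |: U) = mass x U + (if v \in U then 0 else x v).
Proof.
case: ifPn => vU; first by rewrite addr0; congr mass; apply/setUidPr; rewrite sub1set.
by rewrite /mass big_setU1 //= addrC.
Qed.

Lemma massD1 x v U : mass x (U :\ v) = mass x U - (if v \in U then x v else 0).
Proof.
case: ifPn => vU; first by rewrite /mass (big_setD1 v vU) /= addrC addrK.
by rewrite subr0; congr mass; apply/setDidPl; rewrite disjoint_sym disjoints1.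
Qed.

Lemma preim_merge u v U : u != v ->
  merge u v @^-1: U = if u \in U then v |: U else U :\ v.
Proof.
move=> uv; apply/setP => i; rewrite inE /merge.
by case uU: (u \in U); rewrite !inE; case: eqP => [->|_] //=; rewrite uU.
Qed.

(* The fibre over y is parametrised by s = x_v; its two bounds are attained at
   sets U0 and W0 separating u from v, and supermodularity on U0, W0 shows that
   they do not cross. *)
Lemma base_line A u v g t y : u \in A -> v \in A -> u != v -> supermodular g ->
  base (A :\ v) (fun U => g (merge u v @^-1: U)) t y ->
  exists lo (l : nat), forall (w : nat) (s : int),
    base A (fun U => g U + (if inside (u, v) U then w%:Z else 0)) (t + w%:Z)
      (y + spike u (w%:Z - s) + spike v s)
    = (lo <= s < lo + (l + w)%N%:Z).
Proof.
move=> uA vA uv gM /baseP[yA yt yg].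
(* A set containing both or neither of [u], [v] is its own preimage under [merge], so the
   contraction keeps its constraint. *)
have Py U : (u \in U) == (v \in U) -> g U <= mass y U.
  move=> e; apply: le_trans (yg U); rewrite preim_merge //.
  case: ifPn e => uU /eqP/esym vU; last by rewrite le_eqVlt; apply/orP; left;
    apply/eqP; congr g; apply/esym/setDidPl; rewrite disjoint_sym disjoints1 vU.
  by rewrite le_eqVlt; apply/orP; left; apply/eqP; congr g; apply/esym/setUidPr; rewrite sub1set vU.
have [|U0 /andP[uU0 vU0] U0m] := @ex_min_set T (fun U => (u \in U) && (v \notin U))
   (fun U => mass y U - g U) [set u]; first by rewrite !inE eqxx eq_sym.
have [|W0 /andP[vW0 uW0] W0m] := @ex_min_set T (fun U => (v \in U) && (u \notin U))
   (fun U => mass y U - g U) [set v]; first by rewrite !inE eqxx.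
have H0 : 0 <= (mass y U0 - g U0) + (mass y W0 - g W0).
  have := mass_modular y U0 W0; have := gM U0 W0.
  have := Py (U0 :|: W0); have := Py (U0 :&: W0).
  by rewrite !inE (negbTE vU0) (negbTE uW0) uU0 vW0 /= => /(_ isT) + /(_ isT); lia.
(* Write slack for [mass y - g]. The constraint at [W0] reads s >= -slack(W0), the one at [U0] reads
   s <= slack(U0) + w; the [+ 1] counts both end points. *)
exists (- (mass y W0 - g W0)), (absz ((mass y U0 - g U0) + (mass y W0 - g W0) + 1)) => w s.
have -> : (- (mass y W0 - g W0) <= s < - (mass y W0 - g W0) +
  (absz ((mass y U0 - g U0) + (mass y W0 - g W0) + 1)%R + w)%N%:Z) =
  ((- (mass y W0 - g W0) <= s) && (s <= mass y U0 - g U0 + w%:Z)) by lia.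
apply/baseP/andP => [[xA xt xg]|[s1 s2]].
  have := xg U0; have := xg W0; rewrite !massD !mass_spike /inside /=.
  by rewrite (negbTE vU0) (negbTE uW0) uU0 vW0 /=; lia.
split=> [i iA||U].
- rewrite !ffunE yA; last by rewrite !inE negb_and iA orbT.
  by case: eqP iA => [->|_]; rewrite ?uA //; case: eqP => [->|_]; rewrite ?vA.
- by rewrite !massD !mass_spike !inE yt; lia.
rewrite !massD !mass_spike /inside /=.
have := Py U; have := U0m U; have := W0m U.
by case: (u \in U); case: (v \in U) => /= h1 h2 h3; 
  try move: (h1 isT); try move: (h2 isT); try move: (h3 isT); clear - s1 s2; lia.
Qed.

(** Each of the [M] points of the contraction carries a fibre of [l + w] points, with [l]
    independent of [w]; summation gives [N + w * M]. The index in [I] stands for the coordinates of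
    the other edges, over which the count is joint. *)
Lemma has_card_line A u v (I : eqType) (Q : pred I) (g : I -> {set T} -> int)
    (t : I -> int) M :
  u \in A -> v \in A -> u != v -> (forall i, supermodular (g i)) ->
  has_card [pred p : {ffun T -> int} * I |
     Q p.2 && base (A :\ v) (fun U => g p.2 (merge u v @^-1: U)) (t p.2) p.1] M ->
  exists N, forall w : nat, has_card [pred p : {ffun T -> int} * I |
     Q p.2 && base A (fun U => g p.2 U + (if inside (u, v) U then w%:Z else 0))
                (t p.2 + w%:Z) p.1] (N + w * M).
Proof.
move=> uA vA uv gM [Y [uY YP YM]].
have vu : (v == u) = false by rewrite eq_sym; exact/negbTE.
pose P (w : nat) := [pred p : {ffun T -> int} * I |
     Q p.2 && base A (fun U => g p.2 U + (if inside (u, v) U then w%:Z else 0))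
                (t p.2 + w%:Z) p.1].
(* [key] moves [x_v] onto [u] and removes the surplus [w], which recovers [y] from the
   parametrisation in [base_line]. *)
pose key (w : nat) (p : {ffun T -> int} * I) :=
  (p.1 - spike v (p.1 v) + spike u (p.1 v - w%:Z), p.2).
suff /ex_fun_seq[l lP] : forall p, p \in Y -> exists l : nat, forall w : nat,
    has_card [pred q | P w q && (key w q == p)] (l + w).
  exists (\sum_(p <- Y) l p)%N => w.
  have -> : (\sum_(p <- Y) l p + w * M = \sum_(p <- Y) (l p + w))%N.
    by rewrite big_split /= big_const_seq count_predT YM iter_addn_0.
  apply: (@has_card_fibre _ _ (key w)) => //; last by move=> p pY; exact: lP.
  move=> [x i] /andP[/= Qi /baseP[xA xt xg]]; rewrite YP inE /= Qi /=.
  apply/baseP; split=> [k||U].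
  - rewrite !inE negb_and negbK !ffunE => /orP[/eqP->|kA].
      by rewrite eqxx vu /=; lia.
    rewrite (xA _ kA); case: eqP kA => [->|_]; rewrite ?vA // => kA.
    by case: eqP kA => [->|_]; rewrite ?uA //.
  - by rewrite massD massB !mass_spike !inE xt; lia.
  have := xg (merge u v @^-1: U); rewrite massD massB !mass_spike preim_merge //.
  rewrite /inside /=; case: ifP => uU; rewrite ?massU1 ?massD1 !inE eqxx uU ?orbT ?andbF /=.
    by case: (v \in U); lia.
  by case: (v \in U); lia.
move=> [y i]; rewrite YP => /andP[/= Qi by_].
have [lo [l H]] := base_line uA vA uv (gM i) by_.
have yv : y v = 0 by case/baseP: by_ => yA _ _; apply: yA; rewrite !inE eqxx.
exists l => w.
apply: (has_card_bij (f := fun s : int => (y + spike u (w%:Z - s) + spike v s, i))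
  (g := fun p => p.1 v) _ _ (has_card_interval lo (l + w))).
  move=> s /= Hs; rewrite !ffunE eqxx vu yv /= Qi H Hs /=.
  split; last by lia.
  apply/eqP; congr pair; apply/ffunP => k; rewrite !ffunE eqxx vu yv.
  case: (eqVneq k v) => [->|kv]; first by rewrite vu yv /=; lia.
  by case: (eqVneq k u) => [->|ku] /=; lia.
move=> [x i'] /= /andP[/andP[Qi']] + /eqP[yE iE].
have xE : x = y + spike u (w%:Z - x v) + spike v (x v).
  rewrite -yE; apply/ffunP => k; rewrite !ffunE.
  by case: (eqVneq k v) => kv; case: (eqVneq k u) => ku; rewrite ?kv /=; lia.
by rewrite {1}xE iE H => ->; rewrite -xE.
Qed.

End Line.

(** * Ehrhart series and deletion-contraction *)

Section Series.
Implicit Types (h : {poly rat}) (d j : nat).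

(* The coefficient of z^j in h(z) / (1 - z)^(d+1). *)
Definition ser h d j : rat := \sum_(i < j.+1) h`_i * 'C(j - i + d, d)%:R.

Lemma serD h1 h2 d j : ser (h1 + h2) d j = ser h1 d j + ser h2 d j.
Proof. by rewrite -big_split; apply: eq_bigr => i _; rewrite coefD mulrDl. Qed.

Lemma serX0 h d : ser ('X * h) d 0 = 0.
Proof. by rewrite /ser big_ord1 coefXM mul0r. Qed.

Lemma serXS h d j : ser ('X * h) d j.+1 = ser h d j.
Proof.
rewrite /ser big_ord_recl coefXM mul0r add0r; apply: eq_bigr => i _.
by rewrite coefXM /= /bump leq0n /= add1n subSS.
Qed.

Lemma ser_rec h d j : ser h d.+1 j.+1 = ser h d.+1 j + ser h d j.+1.
Proof.
rewrite /ser [LHS]big_ord_recr [X in _ = _ + X]big_ord_recr /= subnn !add0n !binn addrA.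
congr (_ + _); rewrite -big_split; apply: eq_bigr => i _ /=.
by rewrite -mulrDr -natrD subSn ?leq_ord // addSn addnS binS addSn.
Qed.

(** Partial sums multiply a generating function by 1/(1 - z), which raises [d] by one. *)
Lemma ser_sum h d j : \sum_(i < j.+1) ser h d i = ser h d.+1 j.
Proof.
elim: j => [|j IHj]; first by rewrite big_ord1 /ser !big_ord1 !binn.
by rewrite big_ord_recr /= IHj ser_rec.
Qed.

Lemma sum_rev (a : nat -> rat) j : \sum_(k < j.+1) a (j - k)%N = \sum_(k < j.+1) a k.
Proof.
rewrite (reindex_inj rev_ord_inj) /=; apply: eq_bigr => k _.
by rewrite subSS subKn // leq_ord.
Qed.

(** Convolution with z/(1 - z)^2 is a shifted double partial sum. *)
Lemma sum_weighted_rev (a : nat -> rat) j :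
  \sum_(k < j) k.+1%:R * a (j - k.+1)%N = \sum_(i < j) \sum_(k < i.+1) a k.
Proof.
elim: j => [|j IHj]; first by rewrite !big_ord0.
rewrite [RHS]big_ord_recr /= -IHj -sum_rev.
rewrite [X in _ = _ + X]big_ord_recl [LHS]big_ord_recl /= mul1r subSS addrCA; congr (_ + _).
rewrite -big_split; apply: eq_bigr => k _ /=.
by rewrite /bump leq0n /= !add1n subSS -natr1 mulrDl mul1r.
Qed.

(** An edge value b = -k <= 0 shifts by z^k, and b = k + 1 shifts by z^(k+1) and has load 2(k+1).
    The totals 1/(1 - z) + z/(1 - z) and 2z/(1 - z)^2 are the factors applied to the series of [h1]
    and [h2]. *)
Lemma ser_edge h1 h2 d j :
  \sum_(k < j.+1) ser h1 d.+1 (j - k)%N +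
  \sum_(k < j) (ser h1 d.+1 (j - k.+1)%N + 2 * k.+1%:R * ser h2 d (j - k.+1)%N)
  = ser ((1 + 'X) * h1 + 2 * 'X * h2) d.+2 j.
Proof.
rewrite (sum_rev (ser h1 d.+1)) ser_sum big_split /= addrA mulrDl mul1r -mulrA !serD.
have -> : 2 * ('X * h2) = 'X * h2 + 'X * h2 by rewrite mulr_natl mulr2n.
rewrite serD.
case: j => [|j]; first by rewrite !big_ord0 !serX0 !addr0.
under eq_bigr do rewrite subSS.
rewrite (sum_rev (ser h1 d.+1)) ser_sum !serXS; congr (_ + _).
under eq_bigr do rewrite -mulrA.
rewrite -mulr_sumr sum_weighted_rev.
under eq_bigr do rewrite ser_sum.
by rewrite ser_sum mulr_natl mulr2n.
Qed.

Lemma ser_loop h d j :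
  \sum_(k < j.+1) ser h d (j - k)%N + \sum_(k < j) ser h d (j - k.+1)%N
  = ser ((1 + 'X) * h) d.+1 j.
Proof.
rewrite (sum_rev (ser h d)) ser_sum mulrDl mul1r serD; congr (_ + _).
case: j => [|j]; first by rewrite big_ord0 serX0.
under eq_bigr do rewrite subSS.
by rewrite (sum_rev (ser h d)) ser_sum serXS.
Qed.

Lemma ser1 d j : ser 1 d j = 'C(j + d, d)%:R.
Proof.
rewrite /ser big_ord_recl /= coef1 mul1r subn0 big1 ?addr0 // => i _.
by rewrite coef1 mul0r.
Qed.

End Series.

(** * Lattice points of the dilates, one edge at a time *)

Section Points.
Variable T : finType.
Implicit Types (U W A : {set T}) (x y : {ffun T -> int}) (g : {set T} -> int).
Implicit Types (e : T * T) (es : seq (T * T)) (bs : seq int).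

Lemma eq_base A g g' t t' : g =1 g' -> t = t' -> base A g t =1 base A g' t'.
Proof.
move=> gg -> x; rewrite /base; congr [&& _, _ & _].
by apply: eq_forallb => U; rewrite gg.
Qed.

(** A loop at [u] lies inside exactly the sets containing [u], so its load is absorbed by the
    translation by [w] at [u]. *)
Lemma has_card_loop A u (I : eqType) (Q : pred I) (g : I -> {set T} -> int)
    (t : I -> int) N (w : nat) : u \in A ->
  has_card [pred p : {ffun T -> int} * I | Q p.2 && base A (g p.2) (t p.2) p.1] N ->
  has_card [pred p : {ffun T -> int} * I |
     Q p.2 && base A (fun U => g p.2 U + (if inside (u, u) U then w%:Z else 0))
                (t p.2 + w%:Z) p.1] N.
Proof.
move=> uA; apply: (has_card_bij (f := fun p => (p.1 + spike u w%:Z, p.2))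
  (g := fun p => (p.1 - spike u w%:Z, p.2))) => -[x i] /= /andP[-> /baseP[xA xt xg]].
  rewrite addrK; split=> //; apply/baseP; split=> [k kA||U].
  - rewrite !ffunE xA // add0r; by case: eqP kA => // ->; rewrite uA.
  - by rewrite massD mass_spike inE xt.
  by rewrite massD mass_spike /inside /= andbb lerD2r.
rewrite subrK; split=> //; apply/baseP; split=> [k kA||U].
- rewrite !ffunE xA // sub0r; by case: eqP kA => [->|]; rewrite ?uA ?oppr0.
- by rewrite massB mass_spike inE xt addrK.
by have := xg U; rewrite massB mass_spike /inside /= andbb lerBrDr.
Qed.

Definition load es bs U : int :=
  \sum_(p <- zip es bs | inside p.1 U) Num.max 0 (p.2 *+ 2).

Lemma load_cons e es b bs U :
  load (e :: es) (b :: bs) U =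
  load es bs U + (if inside e U then Num.max 0 (b *+ 2) else 0).
Proof. by rewrite /load /= big_cons /=; case: ifP; rewrite ?addr0 // addrC. Qed.

(** An edge inside [U] or inside [W] is inside the union, and one inside both is also inside the
    intersection; nonnegative weights preserve the resulting inequality. *)
Lemma inside_sum_supermodular (I : Type) (r : seq I) (e : I -> T * T) (w : I -> int) :
  (forall i, 0 <= w i) -> supermodular (fun U => \sum_(i <- r | inside (e i) U) w i).
Proof.
move=> w0 U W; rewrite !(big_mkcond (fun i => inside (e i) _)) -!big_split /=.
apply: ler_sum => i _ /=; rewrite /inside !inE /=; have := w0 i.
by case: (_ \in U); case: (_ \in U); case: (_ \in W); case: (_ \in W) => /=; lia.
Qed.

Lemma load_supermodular es bs : supermodular (load es bs).
Proof. by apply: inside_sum_supermodular => p; rewrite le_max lexx. Qed.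

Definition map_edge (phi : T -> T) e := (phi e.1, phi e.2).

(** Links the contraction of a graph, which acts on edges, with that of a set function, which acts
    by preimages. *)
Lemma load_map phi es bs U :
  load (map (map_edge phi) es) bs U = load es bs (phi @^-1: U).
Proof.
elim: es bs => [|e es IH] [|b bs]; rewrite ?load_cons; rewrite /load ?big_nil //=.
by move: (IH bs); rewrite /load => ->; rewrite /inside !inE.
Qed.

(** The lattice points of the [j]-th dilate in the unimodular coordinates, for the graph with nodes
    [A] and edges [es]. Edge coordinates form a list so that the head edge can be peeled off. *)
Definition Pts A es (j : nat) :=
  [pred p : {ffun T -> int} * seq int | (size p.2 == size es) &&
    base A (load es p.2) (j%:Z + \sum_(b <- p.2) b) p.1].

(* Points of Pts A es j with one more edge e, whose load is frozen to w. *)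
Definition PtsW A e es (j w : nat) :=
  [pred p : {ffun T -> int} * seq int | (size p.2 == size es) &&
    base A (fun U => load es p.2 U + (if inside e U then w%:Z else 0))
      (j%:Z + \sum_(b <- p.2) b + w%:Z) p.1].

Lemma load_ge es bs : size bs = size es -> \sum_(b <- bs) b <= load es bs setT.
Proof.
move=> sz; have -> : bs = unzip2 (zip es bs) by rewrite unzip2_zip // sz.
rewrite big_map unzip2_zip ?sz // /load big_mkcond [leRHS]big_mkcond /=.
apply: ler_sum => -[e b] _; rewrite /inside !inE /=; lia.
Qed.

(** The constraint at the full set, with [load_ge] for the remaining edges, leaves 2 max(0, b) - b
    <= j, and the left side is |b|. Thus only finitely many head values occur. *)
Lemma Pts_head_le A es j x b bs : Pts A es j (x, b :: bs) -> `|b| <= j%:Z.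
Proof.
case: es => [|e es] //= /andP[sz /baseP[_ xt xg]].
have H1 := @load_ge es bs (succn_inj (eqP sz)).
have := xg setT; rewrite xt load_cons big_cons /inside !inE /= => H2.
by change (is_true (`|b| <= j%:Z)); move: (\sum_(b <- bs) b) H1 H2 => S; lia.
Qed.

(** Since b + |b| = 2 max(0, b), fixing the head value costs |b| of the dilation factor and leaves
    the load 2 max(0, b). *)
Lemma Pts_cons A e es j (b : int) : `|b| <= j%:Z -> forall p,
  Pts A (e :: es) j (p.1, b :: p.2) = PtsW A e es (j - absz b) (absz (Num.max 0 (b *+ 2))) p.
Proof.
move=> bj [x bs] /=; rewrite eqSS; congr (_ && _); apply: eq_base => [U|].
  by rewrite load_cons; case: ifP => // _; lia.
by rewrite big_cons; lia.
Qed.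

(** The first sum runs over b = -k, where the load vanishes, the second over b = k + 1, where it is
    2(k + 1). *)
Lemma has_card_Pts_cons A e es (a c : nat -> nat) j :
  (forall i w, has_card (PtsW A e es i w) (a i + w * c i)) ->
  has_card (Pts A (e :: es) j)
    (\sum_(k < j.+1) a (j - k) +
     \sum_(k < j) (a (j - k.+1) + 2 * k.+1 * c (j - k.+1)))%N.
Proof.
move=> H.
pose r : seq int := [seq - (k%:Z) | k <- index_iota 0 j.+1] ++ [seq k.+1%:Z | k <- index_iota 0 j].
have memr (b : int) : (b \in r) = (`|b| <= j%:Z).
  rewrite mem_cat; apply/orP/idP => [[]/mapP[k]|bj]; rewrite ?mem_index_iota; try lia.
  case: (lerP b 0) => b0; [left|right]; apply/mapP.
    by exists (absz b); rewrite ?mem_index_iota; lia.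
  by exists (absz b).-1; rewrite ?mem_index_iota; lia.
have ur : uniq r.
  rewrite cat_uniq !map_inj_uniq ?iota_uniq /= ?andbT; try by move=> ? ?; lia.
  by apply/hasPn => b /mapP[k _ ->]; apply/negP => /mapP[l]; lia.
pose N (b : int) := (a (j - absz b) + absz (Num.max 0 (b *+ 2))%R * c (j - absz b))%N.
have -> : (\sum_(k < j.+1) a (j - k) +
     \sum_(k < j) (a (j - k.+1) + 2 * k.+1 * c (j - k.+1)) = \sum_(b <- r) N b)%N.
  rewrite big_cat !big_map !big_mkord; congr (_ + _)%N; apply: eq_bigr => k _; rewrite /N.
    have -> : absz (Num.max 0 (- (k%:Z) *+ 2)) = 0%N by lia.
    by rewrite abszN mul0n addn0.
  by congr (_ + _ * _)%N; lia.
apply: (has_card_fibre (key := fun p => head 0 p.2)) => // [[x [|b bs]]|b].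
- by move=> /andP[].
- by move=> Hp; rewrite memr; exact: Pts_head_le Hp.
rewrite memr => bj; apply: (has_card_bij (f := fun p : {ffun T -> int} * seq int => (p.1, b :: p.2))
  (g := fun p => (p.1, behead p.2)) _ _ (H (j - absz b)%N (absz (Num.max 0 (b *+ 2))))).
  move=> p Hp; have E := Pts_cons A e es bj p; rewrite Hp in E.
  by split; [apply/andP; split; [exact: E|exact: eqxx]|case: (p)].
move=> [x [|b' bs]] /andP[]; first by case/andP.
move=> Hp /eqP b'b; rewrite /= in b'b; rewrite {}b'b in Hp *.
by split=> //; rewrite -(Pts_cons A e es bj (x, bs)).
Qed.

Lemma hockey_stick d j : (\sum_(k < j.+1) 'C(j - k + d, d) = 'C(j + d.+1, d.+1))%N.
Proof.
elim: j => [|j IHj]; first by rewrite big_ord1 !binn.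
rewrite big_ord_recl; under eq_bigr do rewrite lift0 subSS.
by rewrite IHj subn0 addnC -addSnnS [in RHS]addnS binS.
Qed.

(** The edgeless case: the singleton constraints force nonnegativity, so these are the lattice
    points of a dilated standard simplex. They are fibred over the coordinate at one node [v]. *)
Lemma has_card_simplex A d j : #|A| = d.+1 ->
  has_card [pred x | base A (fun=> 0) j%:Z x] 'C(j + d, d).
Proof.
elim: d j A => [|d IHd] j A cA.
  have /cards1P[v ->] : #|A| == 1%N by rewrite cA.
  rewrite addn0 bin0; exists [:: spike v j%:Z]; split=> // x.
  rewrite mem_seq1; apply/eqP/baseP => [->|[xA xt _]].
    split=> [k||U]; rewrite ?mass_spike ?inE ?ffunE; last by case: ifP.
      by move=> /negbTE->.
    by [].
  apply/ffunP => k; rewrite ffunE; case: eqP => [->|/eqP kv]; last by apply: xA; rewrite inE.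
  rewrite -xt /mass (bigD1 v) ?inE //= big1 ?addr0 // => i /andP[_ iv].
  by apply: xA; rewrite inE.
have /card_gt0P[v vA] : (0 < #|A|)%N by rewrite cA.
have cA' : #|A :\ v| = d.+1 by move: cA; rewrite (cardsD1 v) vA => -[].
rewrite -hockey_stick -(big_mkord xpredT (fun k => 'C(j - k + d, d))).
have pos x : (forall U, 0 <= mass x U) -> forall k, 0 <= x k.
  by move=> xg k; have := xg [set k]; rewrite /mass big_set1.
apply: (has_card_fibre (key := fun x => absz (x v))); first exact: iota_uniq.
  move=> x /baseP[xA xt xg]; rewrite mem_index_iota.
  have := xg (setT :\ v); rewrite massD1 inE xt; have := pos x xg v; lia.
move=> k; rewrite mem_index_iota => /andP[_ kj].
apply: (has_card_bij (f := fun x => x + spike v k%:Z) (g := fun x => x - spike v k%:Z)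
  _ _ (IHd (j - k)%N _ cA')) => x.
  move=> /baseP[xA xt xg]; rewrite addrK; split=> //.
  have xv : x v = 0 by apply: xA; rewrite !inE eqxx.
  rewrite /= !ffunE eqxx xv add0r eqxx andbT; apply/baseP; split=> [i iA||U].
  - rewrite !ffunE xA; last by rewrite !inE negb_and iA orbT.
    by case: eqP iA => // ->; rewrite vA.
  - by rewrite massD mass_spike inE xt; lia.
  by rewrite massD mass_spike; apply: addr_ge0 => //; case: ifP.
move=> /andP[/baseP[xA xt xg] /eqP xv]; rewrite subrK; split=> //.
have {}xv : x v = k%:Z by rewrite -xv gez0_abs // pos.
apply/baseP; split=> [i||U].
- rewrite !inE negb_and negbK !ffunE; case: eqP => [->|_ /= iA]; first by rewrite xv subrr.
  by rewrite xA // subr0.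
- by rewrite massB mass_spike inE xt; lia.
by have := xg (U :\ v); rewrite massD1 massB mass_spike xv.
Qed.

(* phi records the contractions made so far. *)
Fixpoint hpoly (phi : T -> T) es : {poly rat} :=
  if es is e :: es' then
    (1 + 'X) * hpoly phi es' +
    (if phi e.1 == phi e.2 then 0
     else 2 * 'X * hpoly (merge (phi e.1) (phi e.2) \o phi) es')
  else 1.

(** Induction on the edges with [phi] and [A] arbitrary, since contracting an edge yields another
    graph of this form with one node fewer. *)
Lemma has_card_Pts phi es A d :
  (forall i, phi i \in A) -> #|A| = d.+1 ->
  exists a : nat -> nat, forall j, has_card (Pts A (map (map_edge phi) es) j) (a j) /\
    (a j)%:R = ser (hpoly phi es) (d + size es) j.
Proof.
elim: es phi A d => [|e es IHes] phi A d phiA cA /=.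
  exists (fun j => 'C(j + d, d)) => j; split; last by rewrite addn0 ser1.
  apply: (has_card_bij (f := fun x => (x, [::])) (g := fun p => p.1) _ _
    (has_card_simplex j cA)).
    move=> x Hx; split=> //=; rewrite big_nil addr0.
    by rewrite -(eq_base _ (g := fun=> 0) _ erefl) // => U; rewrite /load big_nil.
  move=> [x [|b bs]] /andP[//= _]; rewrite big_nil addr0 => Hx; split=> //.
  by rewrite (eq_base _ (g' := load [::] [::]) _ erefl) // => U; rewrite /load big_nil.
have [a Ha] := IHes phi A d phiA cA.
have Ha0 j := (Ha j).1.
case: (eqVneq (phi e.1) (phi e.2)) => [loop|nloop].
  exists (fun j => \sum_(k < j.+1) a (j - k) +
     \sum_(k < j) (a (j - k.+1) + 2 * k.+1 * 0))%N => j; split.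
    apply: (has_card_Pts_cons (c := fun=> 0%N)) => i w; rewrite muln0 addn0.
    rewrite [map_edge phi e]/map_edge -loop.
    exact: (@has_card_loop A (phi e.1) _
      (fun bs => size bs == size (map (map_edge phi) es))
      (load (map (map_edge phi) es)) (fun bs => i%:Z + \sum_(b <- bs) b) (a i) w
      (phiA _) (Ha0 i)).
  rewrite addr0 addnS -ser_loop natrD !natr_sum; congr (_ + _).
    by apply: eq_bigr => k _; exact: (Ha _).2.
  by apply: eq_bigr => k _; rewrite muln0 addn0; exact: (Ha _).2.
(* A single node admits only loops, so here [A] has at least two elements. *)
case: d cA Ha => [|d] cA Ha.
  have /cards1P[v Av] : #|A| == 1%N by rewrite cA.
  by move: (phiA e.1) (phiA e.2) nloop; rewrite Av !inE => /eqP-> /eqP->; rewrite eqxx.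
have cA' : #|A :\ phi e.2| = d.+1 by move: cA; rewrite (cardsD1 (phi e.2)) phiA => -[].
have [|c Hc] := IHes (merge (phi e.1) (phi e.2) \o phi) _ _ _ cA'.
  move=> i; rewrite !inE /= /merge.
  by case: (eqVneq (phi i) (phi e.2)) => [_|ne]; rewrite ?nloop ?ne phiA.
exists (fun j => \sum_(k < j.+1) a (j - k) +
     \sum_(k < j) (a (j - k.+1) + 2 * k.+1 * c (j - k.+1)))%N => j; split.
  apply: has_card_Pts_cons => i w.
  have [|N HN] := @has_card_line T A (phi e.1) (phi e.2) _
     (fun bs => size bs == size (map (map_edge phi) es))
     (load (map (map_edge phi) es)) (fun bs => i%:Z + \sum_(b <- bs) b) (c i)
     (phiA _) (phiA _) nloop (load_supermodular _).
    apply: eq_has_card (Hc i).1 => -[x bs] /=; rewrite !size_map; congr (_ && _).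
    apply: eq_base => // U; rewrite -load_map -map_comp; congr load.
  suff -> : a i = N by exact: HN.
  apply: has_card_uniq (Ha0 i) _; have := HN 0%N; rewrite mul0n addn0; apply: eq_has_card.
  move=> [x bs] /=; congr (_ && _); apply: eq_base => [U|]; rewrite ?addr0 //.
  by case: ifP; rewrite addr0.
(* With [d + size es] as the [d] of [ser_edge], the deletion has index [d.+1], the contraction,
   having lost a node, has [d], and the whole graph has [d.+2]. *)
rewrite addSnnS addnS -addSnnS addSn -ser_edge natrD !natr_sum; congr (_ + _);
  apply: eq_bigr => k _.
  by rewrite -addSn; exact: (Ha _).2.
by rewrite natrD !natrM -addSn (Ha _).2 (Hc _).2.
Qed.

End Points.

(** * Forests and the Tutte polynomial *)

Lemma tutte_shift (F : fieldType) (z : F) : 2 * z != 0 ->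
  (1 + 3 * z) / (2 * z) - 1 = (1 + z) / (2 * z).
Proof. by move=> z2; rewrite -[X in _ - X](divff z2) -mulrBl; congr (_ / _); ring. Qed.

(** Used for a forest with [k] edges, with p = m - r and q = r - k. *)
Lemma expr_split_div (F : fieldType) (a b : F) p q k : b != 0 ->
  a ^+ (p + q) * b ^+ k = a ^+ p * b ^+ (q + k) * (a / b) ^+ q.
Proof.
move=> b0; rewrite !exprD expr_div_n; set c := b ^+ q.
have c0 : c != 0 by exact: expf_neq0.
by field.
Qed.

Section Forests.
Variables (n m : nat) (ends : 'I_m -> 'I_n * 'I_n).
Implicit Types (H : {set 'I_m}) (f : 'I_m) (phi : 'I_n -> 'I_n).

(* phi labels the connected components of (V, H). *)
Definition comp_map H phi := forall x y, connect (adjH ends H) x y = (phi x == phi y).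

Lemma adjH_sym H : symmetric (adjH ends H).
Proof. by move=> x y; apply/exists_inP/exists_inP => -[f fH]; rewrite orbC; exists f. Qed.

Lemma comp_map_root H : comp_map H (fingraph.root (adjH ends H)).
Proof. by move=> x y; rewrite root_connect //; exact: (sym_connect_sym (@adjH_sym _)). Qed.

Lemma comp_map0 : comp_map set0 id.
Proof.
move=> x y; apply/connectP/eqP => [[[|z p] /= + ->] //|->]; last by exists [::].
by case/andP=> /exists_inP[f]; rewrite inE.
Qed.

(** Adding [f] identifies the labels of its two ends; this is the very update of [phi] made in
    [hpoly], which ties contraction to connectivity. *)
Lemma comp_mapU1 H f phi : comp_map H phi ->
  comp_map (f |: H) (merge (phi (ends f).1) (phi (ends f).2) \o phi).
Proof.
move=> K x y; set u := (ends f).1; set v := (ends f).2.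
have sub x' y' : connect (adjH ends H) x' y' -> connect (adjH ends (f |: H)) x' y'.
  apply: connect_sub => a b /exists_inP[g gH ab]; apply: connect1.
  by apply/exists_inP; exists g; rewrite // inE gH orbT.
have uv : connect (adjH ends (f |: H)) u v.
  apply: connect1; apply/exists_inP; exists f; first by rewrite setU11.
  by rewrite -surjective_pairing eqxx.
have vu : connect (adjH ends (f |: H)) v u.
  by rewrite (sym_connect_sym (@adjH_sym _)).
apply/idP/eqP => /=.
  case/connectP => p; elim: p x => [|z p IHp] x /=; first by move=> _ ->.
  case/andP => xz pz yp; rewrite -(IHp z pz yp) /merge.
  case/exists_inP: xz => g; rewrite !inE => /orP[/eqP->|gH] gxz.
    by case/orP: gxz => /eqP fE; rewrite /u /v fE /= eqxx; case: eqP.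
  have /eqP-> // : phi x == phi z.
  by rewrite -K; apply: connect1; apply/exists_inP; exists g.
rewrite /merge; case: (eqVneq (phi x) (phi v)) => xv; case: (eqVneq (phi y) (phi v)) => yv xy.
- by apply: sub; rewrite K xv yv.
- apply: (@connect_trans _ _ v); first by apply: sub; rewrite K xv.
  by apply: connect_trans vu _; apply: sub; rewrite K xy.
- apply: (@connect_trans _ _ u); first by apply: sub; rewrite K xy.
  by apply: connect_trans uv _; apply: sub; rewrite K yv.
- by apply: sub; rewrite K xy.
Qed.

(** [n_comp] counts one root per component, and [phi] is injective on roots while taking all its
    values there. *)
Lemma ncomp_comp_map H phi : comp_map H phi -> ncomp ends H = #|phi @: setT|.
Proof.
move=> K; set e := adjH ends H.
have es : connect_sym e by exact: (sym_connect_sym (@adjH_sym _)).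
have -> : phi @: setT = phi @: [set x | roots e x].
  apply/setP => z; apply/imsetP/imsetP => -[x _ ->]; last by exists x; rewrite ?inE.
  exists (fingraph.root e x); first by rewrite inE roots_root.
  by apply/eqP; rewrite -K connect_root.
rewrite card_in_imset.
  by rewrite /ncomp /n_comp_mem; apply: eq_card => x; rewrite !inE andbT.
move=> x y; rewrite !inE => /eqP <- /eqP <- /eqP; rewrite -K => /(fingraph.rootP es).
by rewrite !root_root.
Qed.

(** A new edge either closes a cycle or joins two components. In the second case the label [b]
    disappears from the image. *)
Lemma nullity_setU1 H f : f \notin H ->
  (ncomp ends (f |: H) + #|f |: H| =
   ncomp ends H + #|H| + connect (adjH ends H) (ends f).1 (ends f).2)%N.
Proof.
move=> fH; have K := comp_map_root H; set phi := fingraph.root _ in K.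
rewrite K (ncomp_comp_map K) (ncomp_comp_map (comp_mapU1 f K)) cardsU1 fH.
rewrite imset_comp; set S := phi @: setT; set a := phi _; set b := phi _.
have aS : a \in S by apply: imset_f.
have bS : b \in S by apply: imset_f.
case: (eqVneq a b) => [->|ab].
  suff -> : merge b b @: S = S by rewrite add1n addnS addn1.
  rewrite -[RHS]imset_id; apply: eq_imset => x; rewrite /merge; by case: eqP => // ->.
suff -> : merge a b @: S = S :\ b by rewrite [#|S|](cardsD1 b S) bS add1n addnS addn0 addSn.
apply/setP => x; apply/imsetP/idP => [[y yS ->]|].
  by rewrite /merge !inE; case: (eqVneq y b) => [_|->]; rewrite ?ab ?aS.
by rewrite !inE => /andP[xb xS]; exists x; rewrite // /merge (negbTE xb).
Qed.

(** Nullity zero, that is, acyclicity, in the form of the exponent of [y - 1] in the Tutte sum. *)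
Definition forest H := (ncomp ends H + #|H| == n)%N.

Lemma forest0 : forest set0.
Proof. by rewrite /forest (ncomp_comp_map comp_map0) imset_id cardsT card_ord cards0 addn0. Qed.

(** The edges of [H'] outside [H] are added one at a time; by [nullity_setU1] each either lowers the
    component count by one or raises the nullity by one. *)
Lemma ncomp_nullity_mono H H' : H \subset H' ->
  (ncomp ends H' <= ncomp ends H)%N /\
  (ncomp ends H + #|H| <= ncomp ends H' + #|H'|)%N.
Proof.
move: {2}#|H' :\: H| (leqnn #|H' :\: H|) => k; elim: k H => [|k IHk] H.
  rewrite leqn0 cards_eq0 setD_eq0 => H'H HH'.
  by have -> : H = H' by apply/eqP; rewrite eqEsubset HH'.
move=> ck HH'; case: (set_0Vmem (H' :\: H)) => [/eqP|[f]].
  rewrite setD_eq0 => H'H.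
  by have -> : H = H' by apply/eqP; rewrite eqEsubset HH'.
rewrite inE => /andP[fH fH'].
have [||c1 c2] := IHk (f |: H).
- by move: ck; rewrite (cardsD1 f) !inE fH fH' add1n ltnS setDDl [H :|: _]setUC.
- by rewrite subUset sub1set fH'.
move: (nullity_setU1 fH) c1 c2; rewrite cardsU1 fH add1n.
by case: (connect _ _ _); rewrite ?addn1 ?addn0 => e c1 c2; split;
  move: e c1 c2; move: #|pred_of_set H| #|pred_of_set H'| (ncomp _ _) (ncomp _ _) (ncomp _ _) => *; lia.
Qed.

Lemma nullity_ge H : (n <= ncomp ends H + #|H|)%N.
Proof. by rewrite -{1}(eqP forest0); case: (ncomp_nullity_mono (sub0set H)). Qed.

(** [H0] holds the edges contracted so far, [s] those still to be treated. Splitting the forests by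
    whether they contain the head edge reproduces the two terms of [hpoly]. *)
Lemma hpoly_forest (s : seq 'I_m) H0 phi : uniq s -> forest H0 ->
  [disjoint H0 & [set f in s]] -> comp_map H0 phi ->
  hpoly phi (map ends s) =
  \sum_(H : {set 'I_m} | (H \subset [set f in s]) && forest (H0 :|: H))
     (1 + 'X) ^+ (size s - #|H|) * (2 * 'X) ^+ #|H|.
Proof.
elim: s H0 phi => [|f s IHs] H0 phi /=.
  move=> _ F0 _ _; rewrite (big_pred1 set0) ?cards0 ?mulr1 // => H.
  have -> : [set f in [::]] = set0 :> {set 'I_m} by apply/setP => f; rewrite !inE.
  by rewrite subset0 /=; case: (eqVneq H set0) => //= ->; rewrite setU0 F0.
move=> /andP[fs us] F0 dis K.
have fH0 : f \notin H0.
  apply/negP => fH0; move/pred0P: dis => /(_ f).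
  by rewrite /= !inE eqxx fH0.
have dis' : [disjoint H0 & [set g in s]].
  apply: disjointWr dis; apply/subsetP => g; rewrite !inE => ->; exact: orbT.
have lsz H : H \subset [set g in s] -> (#|H| <= size s)%N.
  move=> /subset_leq_card /leq_trans; apply.
  by rewrite cardsE; apply: card_size.
have fsub H : H \subset [set g in s] -> f \notin H.
  by move=> /subsetP Hs; apply/negP => /Hs; rewrite inE (negbTE fs).
rewrite [RHS](bigID (fun H : {set 'I_m} => f \notin H)) /=; congr (_ + _).
  rewrite (IHs _ _ us F0 dis' K) mulr_sumr; apply: eq_big => [H|H /andP[Hs _]].
    rewrite andbAC; congr (_ && _); apply/idP/andP => [Hs|[/subsetP Hs fH]].
      split; last exact: fsub.
      by apply: subset_trans Hs _; apply/subsetP => g; rewrite !inE => ->; rewrite orbT.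
    apply/subsetP => g gH; move: (Hs _ gH); rewrite !inE => /orP[/eqP gf|//].
    by rewrite -gf gH in fH.
  by rewrite subSn ?lsz // exprS mulrA.
(* The sets containing [f] are written [f |: H], and [f] then moves over to [H0]. *)
rewrite (reindex_onto (fun H => f |: H) (fun H => H :\ f)) /=; last first.
  by move=> H /andP[_]; rewrite negbK; apply: setD1K.
have P H : ((f |: H \subset [set g in f :: s]) && forest (H0 :|: (f |: H)) && ~~ (f \notin f |: H)
    && ((f |: H) :\ f == H)) =
    ((H \subset [set g in s]) && forest ((f |: H0) :|: H)).
  rewrite negbK setU11 andbT setUCA setUA andbAC; congr (_ && _).
  apply/andP/idP => [[/subsetP Hs /eqP E]|Hs].
    apply/subsetP => g; rewrite -E !inE => /andP[gf /orP[/eqP|gH]]; first by move/eqP: gf.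
    by have := Hs g; rewrite !inE gH (negbTE gf) orbT => /(_ isT).
  split; last by rewrite setU1K // fsub.
  apply/subsetP => g; rewrite !inE => /orP[->//|/(subsetP Hs)].
  by rewrite inE => ->; rewrite orbT.
rewrite (eq_bigl _ _ P).
(* If [H0] already connects the ends of [f], then [f] closes a cycle, and monotonicity of the
   nullity excludes every larger set. *)
case: ifPn => [loop|nloop].
  rewrite big_pred0 // => H; apply/negP => /andP[Hs]; rewrite /forest => /eqP F.
  have [_] := ncomp_nullity_mono (subsetUl (f |: H0) H).
  by rewrite F nullity_setU1 // (eqP F0) K loop addn1 ltnn.
have F1 : forest (f |: H0) by rewrite /forest nullity_setU1 // K (negbTE nloop) addn0.
rewrite (IHs _ _ us F1 _ (comp_mapU1 f K)); last first.
  apply/pred0P => g /=; rewrite !inE.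
  case: eqP => [->|_ /=]; first by rewrite (negbTE fs) andbF.
  by have := pred0P dis' g; rewrite /= inE.
rewrite mulr_sumr; apply: eq_bigr => H /andP[Hs _].
by rewrite cardsU1 fsub //= add1n subSS exprS mulrCA mulrA.
Qed.

(** At y = 1 the factor 0^nullity keeps exactly the forests, with 0^0 = 1, and the surviving terms
    are matched with those of [hpoly_forest]. *)
Lemma tutte_hpoly :
  let z : {fraction {poly rat}} := tofracF 'X in
  tofracF (hpoly id (map ends (enum 'I_m))) =
   (1 + z) ^+ (m - grank ends) * (2 * z) ^+ grank ends *
           tutte ends ((1 + 3 * z) / (2 * z)) 1.
Proof.
move=> z.
have z2 : 2 * z != 0.
  have -> : 2 * z = tofracF (2 * 'X) by rewrite rmorphM rmorph_nat.
  rewrite tofrac_eq0 mulf_neq0 ?polyX_eq0 //.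
  by rewrite -(rmorph_nat (polyC : {rmorphism rat -> {poly rat}})) polyC_eq0 pnatr_eq0.
have dis : [disjoint set0 & [set f in enum 'I_m]].
  by apply/pred0P => f /=; rewrite inE.
rewrite (hpoly_forest (enum_uniq _) forest0 dis comp_map0) rmorph_sum /= size_enum_ord.
rewrite /tutte mulr_sumr big_mkcond [RHS](bigID forest) /=.
rewrite [X in _ = _ + X]big1 ?addr0 => [|H nF]; last first.
  have := nullity_ge H; rewrite leq_eqVlt eq_sym => /orP[|lt].
    by rewrite -/(forest H) (negbTE nF).
  by rewrite subrr expr0n subn_eq0 leqNgt lt /= !mulr0.
rewrite -big_mkcond /=; apply: eq_big => [H|H].
  rewrite set0U andb_idl // => _; apply/subsetP => f _; by rewrite inE mem_enum.
rewrite set0U => /andP[_ F]; rewrite -/z.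
rewrite subrr (eqP F) subnn expr0 mulr1.
rewrite (tutte_shift z2).
have FT := nullity_ge setT; rewrite cardsT card_ord in FT.
have [ET FH] := ncomp_nullity_mono (subsetT H); rewrite (eqP F) cardsT card_ord in FH.
have cH : (#|H| <= m)%N by rewrite -[X in (_ <= X)%N]card_ord max_card.
have F' := eqP F.
rewrite rmorphM !rmorphXn /= rmorphD rmorph1 rmorphM rmorph_nat -/z.
have : grank ends = (n - ncomp ends setT)%N by [].
move: F' FT FH cH ET; move: (grank ends) (ncomp ends H) (ncomp ends setT) #|pred_of_set H|.
move=> r cH cT k F' FT FH kH ET rE.
(* [FT] gives r <= m and [ET] with [F'] gives k <= r, so the truncated subtractions are exact. *)
have -> : (cH - cT = r - k)%N by lia.
have -> : (m - k = (m - r) + (r - k))%N by lia.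
have kr : (k <= r)%N by lia.
by rewrite (expr_split_div (1 + z) _ _ _ z2) (subnK kr).
Qed.

End Forests.

(** * Dilates of the cosmological polytope *)

Section Decomposition.
Variable T : finType.
Implicit Types (U W A : {set T}) (x y : {ffun T -> int}) (g : {set T} -> int).

(** The share [p] of [a] is taken as large as the sets containing [a] but not [b] permit. If this is
    less than [w], a tightest such set [U0] is uncrossed with any set containing [b] but not [a]:
    their union contains the edge, which leaves room for [w - p]. *)
Lemma edge_split g x a b (w : int) : supermodular g -> 0 <= w ->
  (forall U, g U + (if inside (a, b) U then w else 0) <= mass x U) ->
  exists2 p, 0 <= p <= w &
    forall U, g U <= mass (x - spike a p - spike b (w - p)) U.
Proof.
move=> gM w0 H; case: (eqVneq a b) => [ab|ab].
  exists 0; rewrite ?lexx // => U; have := H U.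
  by rewrite !massB !mass_spike -ab /inside /= andbb; case: (a \in U); lia.
have [|U0 /andP[aU0 bU0] U0m] := @ex_min_set T (fun U => (a \in U) && (b \notin U))
   (fun U => mass x U - g U) [set a]; first by rewrite !inE eqxx eq_sym.
have HU0 := H U0; rewrite /inside /= aU0 (negbTE bU0) /= in HU0.
have [p [p0 pw pm pM]] : exists p : int, [/\ 0 <= p, p <= w, p <= mass x U0 - g U0 &
    p = w \/ p = mass x U0 - g U0].
  case: (lerP w (mass x U0 - g U0)) => c; [exists w|exists (mass x U0 - g U0)]; split=> //; lia.
exists p => [|U]; first by rewrite p0.
have := H U; have := U0m U; rewrite !massB !mass_spike /inside /=.
case aU: (a \in U); case bU: (b \in U) => /= h1 h2; try lia.
case: pM => pE; first lia.
have := mass_modular x U0 U; have := gM U0 U.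
have := H (U0 :|: U); have := H (U0 :&: U).
rewrite /inside /= !inE aU bU aU0 (negbTE bU0) /=; lia.
Qed.

(** Sufficiency in Hall form: [edge_split] settles one edge at a time, the load of the others being
    the supermodular [g]. Once no edge is left, the singleton constraints say that the remainder is
    nonnegative. *)
Lemma orientation_below (I : eqType) (r : seq I) (e : I -> T * T) (w : I -> int) x :
  uniq r -> (forall i, 0 <= w i) ->
  (forall U, \sum_(i <- r | inside (e i) U) w i <= mass x U) ->
  exists2 p : I -> int, (forall i, 0 <= p i <= w i) &
    forall u, \sum_(i <- r) (p i * (u == (e i).1)%:R + (w i - p i) * (u == (e i).2)%:R) <= x u.
Proof.
move=> + w0; elim: r x => [|i r IHr] x /=.
  move=> _ H; exists w => [i|u]; first by rewrite w0 lexx.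
  by have := H [set u]; rewrite /mass big_set1 !big_nil.
move=> /andP[ir ur] H.
have [|q qw /(IHr _ ur)[p pw pH]] := @edge_split _ x (e i).1 (e i).2 _
    (inside_sum_supermodular r e w0) (w0 i).
  move=> U; rewrite -surjective_pairing; have := H U; rewrite big_cons.
  by case: ifP => _; rewrite ?addr0 // addrC.
exists (fun k => if k == i then q else p k) => [k|u].
  by case: eqP => [->|_].
have := pH u; rewrite !ffunE big_cons eqxx => pHu.
rewrite (eq_big_seq (fun k => p k * (u == (e k).1)%:R + (w k - p k) * (u == (e k).2)%:R)).
  move: pHu; move: (\sum_(_ <- _) _) => S.
  by case: (u == _); case: (u == _) => /=; rewrite ?mulr1 ?mulr0; lia.
by move=> k kr; have -> : (k == i) = false by apply: contraNF ir => /eqP<-.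
Qed.

End Decomposition.

Section Dilate.
Variables (R : realFieldType) (n m : nat) (ends : 'I_m -> 'I_n * 'I_n).

Lemma sum_gen_idx (V : zmodType) (F : gen_idx n m -> V) :
  \sum_i F i = \sum_u F (inl u) +
   \sum_f (F (inr (f, inord 0)) + F (inr (f, inord 1)) +
             F (inr (f, inord 2)) + F (inr (f, inord 3))).
Proof.
rewrite big_sumType /=; congr (_ + _).
transitivity (\sum_f \sum_k F (inr (f, k))).
  by rewrite pair_bigA /=; apply: eq_bigr => -[].
apply: eq_bigr => f _.
rewrite !big_ord_recl big_ord0 addr0 !addrA.
by do !congr (_ + _); congr (F (inr (f, _))); apply: val_inj; rewrite /= inordK.
Qed.

Definition fst_end (u : 'I_n) f : R := (u == (ends f).1)%:R.
Definition snd_end (u : 'I_n) f : R := (u == (ends f).2)%:R.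

(* s and t0, ..., t3 are the weights of e_u, e_f, ~e_f, <-e_f, ->e_f. *)
Definition cone_coords (s : 'I_n -> R) (t0 t1 t2 t3 : 'I_m -> R) (c : coord_t n m) : R :=
  match c with
  | inl u => s u + \sum_f (t1 f * (fst_end u f + snd_end u f) +
       t2 f * (fst_end u f - snd_end u f) + t3 f * (snd_end u f - fst_end u f))
  | inr f => t0 f - t1 f + t2 f + t3 f
  end.

Lemma sum_cosmo_gen (lam : gen_idx n m -> R) d :
  \sum_i lam i * @cosmo_gen R n m ends i d =
  cone_coords (fun u => lam (inl u)) (fun f => lam (inr (f, inord 0)))
    (fun f => lam (inr (f, inord 1))) (fun f => lam (inr (f, inord 2)))
    (fun f => lam (inr (f, inord 3))) d.
Proof.
rewrite sum_gen_idx /cosmo_gen /= !inordK // /basisv.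
case: d => [u|g] /=.
  congr (_ + _); last first.
    by apply: eq_bigr => f _; rewrite /fst_end /snd_end; ring.
  rewrite (bigD1 u) //= eqxx mulr1 big1 ?addr0 // => v vu.
  by rewrite (inj_eq inl_inj) eq_sym (negbTE vu) mulr0.
rewrite big1 ?add0r; last by move=> v _; rewrite mulr0.
rewrite (bigD1 g) //= eqxx big1 ?addr0; first by rewrite mulr1n; ring.
move=> f fg; have -> : (inr g == inr f :> coord_t n m) = false; last by rewrite mulr0n; ring.
by rewrite (inj_eq inr_inj) eq_sym; exact/negbTE.
Qed.

(** Scaling by [j] turns convex weights into nonnegative weights of total [j]. *)
Lemma in_dilateP j (x : coord_t n m -> R) : (0 < n)%N ->
  in_dilate_cosmo ends j x <->
  exists s t0 t1 t2 t3, [/\ (forall u, 0 <= s u),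
    (forall f, [/\ 0 <= t0 f, 0 <= t1 f, 0 <= t2 f & 0 <= t3 f]),
    \sum_u s u + \sum_f (t0 f + t1 f + t2 f + t3 f) = j%:R &
    forall d, x d = cone_coords s t0 t1 t2 t3 d].
Proof.
move=> n0; split=> [[lam [lam0 [lam1 xE]]]|[s [t0 [t1 [t2 [t3 [s0 t_0 st xE]]]]]]].
  exists (fun u => j%:R * lam (inl u)), (fun f => j%:R * lam (inr (f, inord 0))),
    (fun f => j%:R * lam (inr (f, inord 1))), (fun f => j%:R * lam (inr (f, inord 2))),
    (fun f => j%:R * lam (inr (f, inord 3))); split.
  - by move=> u; rewrite mulr_ge0.
  - by move=> f; split; rewrite mulr_ge0.
  - rewrite -[RHS]mulr1 -lam1 sum_gen_idx mulrDr !mulr_sumr; congr (_ + _).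
    by apply: eq_bigr => f _; ring.
  move=> d; rewrite xE sum_cosmo_gen; case: d => [u|f] /=; last by ring.
  by rewrite mulrDr mulr_sumr; congr (_ + _); apply: eq_bigr => f _; ring.
(* For j = 0 all weights vanish and cannot be rescaled to total 1; the unit weight on a node [u0]
   serves instead. *)
case: j st => [|j] st.
  pose u0 := Ordinal n0.
  have T0 f : 0 <= t0 f + t1 f + t2 f + t3 f by case: (t_0 f) => *; rewrite !addr_ge0.
  have /eqP := st; rewrite paddr_eq0 ?sumr_ge0 // !psumr_eq0 //.
  move=> /andP[/allP sz /allP tz].
  have sE u : s u = 0 by apply/eqP/(implyP (sz u _)) => //; rewrite mem_index_enum.
  have tE f : [/\ t1 f = 0, t2 f = 0, t3 f = 0 & t0 f = 0].
    have /eqP : t0 f + t1 f + t2 f + t3 f == 0.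
      by apply: (implyP (tz f _)) => //; rewrite mem_index_enum.
    by case: (t_0 f) => *; split; lra.
  exists (fun i => (i == inl u0)%:R); split; first by move=> i; rewrite ler0n.
  split; first by rewrite (bigD1 (inl u0)) // eqxx big1 => [|i /negbTE-> //]; rewrite /= addr0.
  move=> d; rewrite mul0r xE; case: d => [u|f] /=.
    rewrite sE big1 ?addr0 // => f _; case: (tE f) => -> -> -> _; ring.
  by case: (tE f) => -> -> -> ->; ring.
have j0 : j.+1%:R != 0 :> R by rewrite pnatr_eq0.
pose tk f (k : 'I_4) := match val k with 0 => t0 f | 1 => t1 f | 2 => t2 f | _ => t3 f end.
exists (fun i => (match i with inl u => s u | inr (f, k) => tk f k end) / j.+1%:R).
split=> [[u|[f k]]|].
- by rewrite divr_ge0.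
- apply: divr_ge0 => //; case: (t_0 f) => *.
  by rewrite /tk; case: k => [] [|[|[|k]]].
split=> [|d].
  rewrite sum_gen_idx -mulr_suml /tk /= !inordK //.
  under [X in _ + X]eq_bigr do rewrite -!mulrDl.
  by rewrite -mulr_suml -mulrDl st divff.
rewrite xE sum_cosmo_gen /tk /= !inordK //.
move: j.+1%:R j0 => J J0; case: d => [u|f] /=; last by field.
rewrite mulrDr mulr_sumr; congr (_ + _); first by field.
by apply: eq_bigr => f _; field.
Qed.

End Dilate.

(** * Passage to the unimodular coordinates *)

Section Coordinates.
Variables (n m : nat) (ends : 'I_m -> 'I_n * 'I_n).
Implicit Types (z : {ffun coord_t n m -> int}) (U : {set 'I_n}).

Definition mult (u : 'I_n) (f : 'I_m) : int := (u == (ends f).1)%:R + (u == (ends f).2)%:R.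

(** This shear gives the generators [e_f], [~e_f], [<-e_f], [->e_f] the vertex parts e_u + e_v, 0, 2
    e_u, 2 e_v, all nonnegative; for a loop u = v. *)
Definition vertex_part z : {ffun 'I_n -> int} :=
  [ffun u => z (inl u) + \sum_f z (inr f) * mult u f].

Definition edge_part z : seq int := [seq z (inr f) | f <- enum 'I_m].

Definition edge_list : seq ('I_n * 'I_n) := [seq ends f | f <- enum 'I_m].

Lemma sum_edge_part z : \sum_(b <- edge_part z) b = \sum_f z (inr f).
Proof. by rewrite big_map big_enum. Qed.

Lemma load_edge_part z U :
  load edge_list (edge_part z) U = \sum_(f | inside (ends f) U) Num.max 0 (z (inr f) *+ 2).
Proof.
rewrite /load /edge_list /edge_part zip_map big_map /= big_enum_cond.
by apply: eq_bigl => f; rewrite inE.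
Qed.

Lemma has_card_vertex_edge_parts j N :
  has_card (Pts setT edge_list j) N ->
  has_card [pred z | Pts setT edge_list j (vertex_part z, edge_part z)] N.
Proof.
(* The inverse shear, again with integer coefficients. *)
pose g (p : {ffun 'I_n -> int} * seq int) : {ffun coord_t n m -> int} :=
  [ffun c => match c with
             | inl u => p.1 u - \sum_f p.2`_(val f) * mult u f
             | inr f => p.2`_(val f)
             end].
have gK p : size p.2 = size edge_list -> (vertex_part (g p), edge_part (g p)) = p.
  case: p => x bs /=; rewrite size_map size_enum_ord => sz; congr pair.
    apply/ffunP => u; rewrite !ffunE /= -[RHS](subrK (\sum_f bs`_(val f) * mult u f)).
    by congr (_ + _); apply: eq_bigr => f _; rewrite ffunE.
  apply: (@eq_from_nth _ 0); first by rewrite size_map size_enum_ord.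
  move=> i; rewrite size_map size_enum_ord => im.
  rewrite (nth_map (Ordinal im)) ?size_enum_ord // ffunE /=.
  by rewrite nth_enum_ord.
apply: (has_card_bij (f := g) (g := fun z => (vertex_part z, edge_part z))) => [p Hp|z Hz].
  have E : (vertex_part (g p), edge_part (g p)) = p.
    by apply: gK; apply/eqP; case/andP: Hp.
  split=> //; change (is_true (Pts setT edge_list j (vertex_part (g p), edge_part (g p)))).
  by rewrite E.
split=> //; apply/ffunP => -[u|f]; rewrite !ffunE /=; last first.
  by rewrite (nth_map f) ?size_enum_ord // nth_ord_enum.
rewrite -[RHS](addrK (\sum_f z (inr f) * mult u f)); congr (_ - _).
apply: eq_bigr => f _.
by rewrite (nth_map f) ?size_enum_ord // nth_ord_enum.
Qed.

Variable R : realFieldType.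

Lemma sum_indicator U u0 : \sum_(u in U) (u == u0)%:R = (u0 \in U)%:R :> R.
Proof.
rewrite big_mkcond (bigD1 u0) //= eqxx big1 ?addr0; first by case: (u0 \in U).
by move=> u /negbTE->; case: ifP.
Qed.

Lemma intr_mult u f : (mult u f)%:~R = fst_end R ends u f + snd_end R ends u f.
Proof. by rewrite /mult /fst_end /snd_end rmorphD /= !rmorph_nat. Qed.

Lemma in_dilate_Pts j z : (0 < n)%N ->
  in_dilate_cosmo ends j (fun d => (z d)%:~R : R) <->
  Pts setT edge_list j (vertex_part z, edge_part z).
Proof.
move=> n0; rewrite in_dilateP //; split.
  move=> [s [t0 [t1 [t2 [t3 [s0 t_0 st xE]]]]]].
  have bE f : (z (inr f))%:~R = t0 f - t1 f + t2 f + t3 f by rewrite (xE (inr f)).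
  (* By the vertex parts of the generators, an edge inside [U] contributes 2(t0 + t2 + t3) >= 2
     max(0, b_f), and any other edge a nonnegative amount. *)
  have mE U : (mass (vertex_part z) U)%:~R = \sum_(u in U) s u +
     \sum_f (t0 f * (((ends f).1 \in U)%:R + ((ends f).2 \in U)%:R)
       + 2 * t2 f * ((ends f).1 \in U)%:R + 2 * t3 f * ((ends f).2 \in U)%:R).
    rewrite /mass rmorph_sum /=.
    under [X in _ = _ + X]eq_bigr
      do rewrite -!sum_indicator -big_split /= !mulr_sumr -!big_split /=.
    rewrite exchange_big -big_split /=; apply: eq_bigr => u _.
    rewrite ffunE rmorphD /= rmorph_sum /= (xE (inl u)) /= -addrA -big_split /=; congr (_ + _).
    by apply: eq_bigr => f _; rewrite rmorphM /= intr_mult bE /fst_end /snd_end; ring.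
  apply/andP; split; first by rewrite /= !size_map.
  apply/baseP; split=> [u|/=|U /=]; first by rewrite inE.
    apply/eqP; rewrite -(eqr_int R) mE rmorphD /= sum_edge_part rmorph_sum /=.
    rewrite -[(Posz j)%:~R]/(j%:R) -st -addrA -big_split /=; apply/eqP; congr (_ + _).
      by apply: eq_bigl => u; rewrite inE.
    by apply: eq_bigr => f _; rewrite !inE bE /=; ring.
  rewrite -(ler_int R) mE load_edge_part rmorph_sum /= -[leLHS]add0r.
  apply: lerD; first exact: sumr_ge0.
  rewrite big_mkcond /=; apply: ler_sum => f _; rewrite /inside.
  have [p0 p1 p2 p3] := t_0 f; have bf := bE f.
  case: ((ends f).1 \in U); case: ((ends f).2 \in U) => /=;
    rewrite ?mulr1 ?mulr0 ?addr0 ?add0r; try lra.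
  by rewrite maxEle; case: ifP => _; rewrite ?rmorphMn /= ?bf; lra.
move=> /andP[_ /baseP[/= _ xt xg]].
pose w f := Num.max 0 (z (inr f) *+ 2).
have w0 f : 0 <= w f by rewrite le_max lexx.
have [|p pw pH] := @orientation_below _ _ (enum 'I_m) ends w (vertex_part z) (enum_uniq _) w0.
  by move=> U; have := xg U; rewrite load_edge_part big_enum_cond.
pose P f : R := (p f)%:~R; pose W f : R := (w f)%:~R; pose B f : R := (z (inr f))%:~R.
have P0 f : 0 <= P f by rewrite ler0z; case/andP: (pw f).
have PW f : P f <= W f by rewrite ler_int; case/andP: (pw f).
have WB f : B f <= W f / 2 by rewrite ler_pdivlMr // mulr_natr -rmorphMn ler_int le_max lexx orbT.
pose D u f := P f * fst_end R ends u f + (W f - P f) * snd_end R ends u f.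
(* The arrows take the two shares of [w], halved because their vertex parts are 2 e_u and 2 e_v; the
   weight of [e_f], their midpoint, is placed on them. [~e_f] gets w/2 - b = max(0, -b), and the
   nodes get what [orientation_below] leaves over. *)
exists (fun u => (vertex_part z u)%:~R - \sum_f D u f), (fun=> 0), (fun f => W f / 2 - B f),
  (fun f => P f / 2), (fun f => (W f - P f) / 2); split.
- move=> u; rewrite subr_ge0; move: (pH u); rewrite -(ler_int R) big_enum rmorph_sum /=.
  congr (_ <= _); apply: eq_bigr => f _.
  by rewrite rmorphD !rmorphM /= rmorphB /= !rmorph_nat.
- move=> f; split=> //; rewrite ?divr_ge0 ?subr_ge0 //.
- have Dsum : \sum_u \sum_f D u f = \sum_f W f.
    rewrite exchange_big; apply: eq_bigr => f _.
    rewrite big_split /= -!mulr_sumr.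
    have S u0 : \sum_u (u == u0)%:R = 1 :> R.
      by rewrite (bigD1 u0) //= eqxx big1 ?addr0 // => u /negbTE->.
    by rewrite /fst_end /snd_end !S; ring.
  rewrite sumrB Dsum -rmorph_sum /=.
  have -> : \sum_u vertex_part z u = j%:Z + \sum_f z (inr f).
    by rewrite -sum_edge_part -xt; apply: eq_bigl => u; rewrite inE.
  rewrite rmorphD /= rmorph_sum /= -addrA -addrA -sumrN -!big_split /= big1 ?addr0 //.
  by move=> f _; rewrite -/(B f); field.
case=> [u|f] /=; last by rewrite -/(B f); field.
rewrite ffunE rmorphD /= rmorph_sum /= -!addrA -sumrN -!big_split /= big1 ?addr0 //.
by move=> f _; rewrite rmorphM /= intr_mult -/(B f) /D; field.
Qed.

End Coordinates.

Theorem mainTheorem13 (R : realFieldType) (n m : nat)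
    (ends : 'I_m -> 'I_n * 'I_n) :
  (0 < n)%N ->
  exists h : {poly rat},
    @is_hstar_cosmo R n m ends h /\
    let z : {fraction {poly rat}} := tofracF 'X in
    tofracF h = (1 + z) ^+ (m - grank ends) * (2 * z) ^+ grank ends *
           tutte ends ((1 + 3 * z) / (2 * z)) 1.
Proof.
move=> n0; exists (hpoly id (map ends (enum 'I_m))); split; last exact: tutte_hpoly.
have cT : #|[set: 'I_n]| = n.-1.+1 by rewrite cardsT card_ord prednK.
(* Nothing is contracted at the start, so [phi] is the identity on all [n] nodes, and the index
   [n.-1 + m] is the dimension of the polytope. *)
have [a aP] := @has_card_Pts _ id (edge_list ends) setT _ (@in_setT _) cT.
move=> j; have [+ aE] := aP j.
have -> : map (map_edge id) (edge_list ends) = edge_list ends.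
  by rewrite -[RHS]map_id; apply: eq_map => -[].
case/has_card_vertex_edge_parts => s [us sP sz]; exists s; split=> //.
  by move=> z; rewrite sP in_dilate_Pts.
rewrite sz aE /ser; apply: eq_bigr => i _; rewrite size_map size_enum_ord.
by have -> : (n.-1 + m = (n + m).-1)%N by rewrite -[in RHS](prednK n0).
Qed.
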